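(* Let $\mathcal{G}=(\mathcal{V},\mathcal{E})$ be a finite, simple, strongly connected directed graph with $m=|\mathcal{E}|$ edges, equipped with a fixed directed distance function $d$ and a fixed balancing factor $\beta:\mathcal{V}\to[0,1]$. For a positive edge weight vector $\mathbf{w}=(w_e)_{e\in\mathcal{E}}\in\mathbb{R}_{>0}^m$ and an edge $e=(x,y)\in\mathcal{E}$, let $\kappa_e(\mathbf{w})=\kappa(x,y)$ be the directed Lin--Lu--Yau Ricci curvature from $x$ to $y$ of the weighted digraph $(\mathcal{V},\mathcal{E},\mathbf{w},d)$. Let $\mathbf{w}^0=(w_e^0)_{e\in\mathcal{E}}\in\mathbb{R}_{>0}^m$ satisfy $\sum_{e\in\mathcal{E}}w_e^0=1$. Then the initial value problem $$ \mathbf{w}(0)=\mathbf{w}^0,\qquad \frac{d w_e(t)}{dt}=-\kappa_e(\mathbf{w}(t))\,w_e(t)+w_e(t)\sum_{h\in\mathcal{E}}\kappa_h(\mathbf{w}(t))\,w_h(t)\qquad (e\in\mathcal{E}) $$ has a unique solution $\mathbf{w}(t)=(w_e(t))_{e\in\mathcal{E}}\in\mathbb{R}_{>0}^m$ for $t\in[0,+\infty)$.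
   Context: Digraphs: $\mathcal{G}=(\mathcal{V},\mathcal{E})$ has a finite vertex set $\mathcal{V}$ and edge set $\mathcal{E}\subseteq\mathcal{V}\times\mathcal{V}$ of ordered pairs; $(x,y)\in\mathcal{E}$ is also written $x\to y$. Simple means no loops and no multiple edges with the same direction (both $x\to y$ and $y\to x$ may be present). Strongly connected means that for every ordered pair of distinct vertices there is a directed path from the first to the second. Distance: each edge $u\to v$ has a fixed positive length $d_{uv}$. A directed path from $x$ to $y$ is a sequence of distinct vertices $v_0\to v_1\to\dots\to v_k$ with $v_0=x$, $v_k=y$; its length is $\sum_{i=0}^{k-1}d_{v_iv_{i+1}}$. The directed distance $d(x,y)$ is the infimum of lengths of directed paths from $x$ to $y$ (so $d(x,x)=0$; $d$ satisfies the triangle inequality but need not be symmetric). The distance $d$ is independent of the edge weights $w$ and does not change with time. Transition kernel: for weights $w:\mathcal{E}\to\mathbb{R}_{>0}$ put $P(x,z)=\dfrac{w_{xz}}{\sum_{u:\,x\to u}w_{xu}}$ if $x\to z$ and $P(x,z)=0$ otherwise; $P'(x,z)=\dfrac{w_{zx}}{\sum_{u:\,u\to x}w_{ux}}$ if $z\to x$ and $P'(x,z)=0$ otherwise. The balancing transition kernel is $\mathcal{P}(x,z)=\beta(x)P(x,z)+(1-\beta(x))P'(x,z)$. Measures: for $\alpha\in[0,1]$, $\mu_x^\alpha$ is the probability distribution on $\mathcal{V}$ with $\mu_x^\alpha(x)=\alpha$ and $\mu_x^\alpha(z)=(1-\alpha)\mathcal{P}(x,z)$ for $z\neq x$. Wasserstein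 distance: $W_1(\mu,\nu)=\inf_{\pi}\sum_{(u,v)\in\mathcal{V}\times\mathcal{V}}\pi(u,v)d(u,v)$, the infimum over all $\pi:\mathcal{V}\times\mathcal{V}\to[0,\infty)$ with $\sum_v\pi(u,v)=\mu(u)$ for all $u$ and $\sum_u\pi(u,v)=\nu(v)$ for all $v$. Curvature: for $x\ne y$, $\kappa_\alpha(x,y)=1-\dfrac{W_1(\mu_x^\alpha,\mu_y^\alpha)}{d(x,y)}$, and the directed Lin--Lu--Yau Ricci curvature is $\kappa(x,y)=\lim_{\alpha\to1^-}\dfrac{\kappa_\alpha(x,y)}{1-\alpha}$ (this limit exists). *)

(* Defs.v *)
From mathcomp Require Import all_boot all_order all_algebra.
From mathcomp Require Import all_classical all_reals all_analysis.

Set Implicit Arguments.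
Unset Strict Implicit.
Unset Printing Implicit Defensive.

Import Order.TTheory GRing.Theory Num.Theory.
Import numFieldNormedType.Exports.

Local Open Scope classical_set_scope.
Local Open Scope ring_scope.

Section Digraph.
Variables (V : finType) (G : rel V).

(* The path v_0 -> v_1 -> ... -> v_k is stored as x = v_0 together with
   p = [:: v_1; ...; v_k]. *)
Definition dipath (x y : V) (p : seq V) : Prop :=
  [/\ path G x p, last x p = y & uniq (x :: p)].

Definition strongly_connected : Prop :=
  forall x y : V, x != y -> exists p : seq V, dipath x y p.

End Digraph.

Notation edge G := {e : _ * _ | G e.1 e.2}.

Section Curvature.
Variables (R : realType) (V : finType) (G : rel V).

(* Only the values of len on the edges of G matter. *)
Variable len : V -> V -> R.

Definition path_length (x : V) (p : seq V) : R :=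
  \sum_(l <- pairmap len x p) l.

Definition dist (x y : V) : R :=
  inf [set path_length x p | p in [set p | dipath G x y p]].

(* The extension of w by 0 to pairs that are not edges. *)
Definition weight (w : edge G -> R) (x z : V) : R :=
  if insub (x, z) is Some e then w e else 0.

Definition out_kernel (w : edge G -> R) (x z : V) : R :=
  if G x z then weight w x z / \sum_(u | G x u) weight w x u else 0.

Definition in_kernel (w : edge G -> R) (x z : V) : R :=
  if G z x then weight w z x / \sum_(u | G u x) weight w u x else 0.

Variable beta : V -> R.

Definition balancing_kernel (w : edge G -> R) (x z : V) : R :=
  beta x * out_kernel w x z + (1 - beta x) * in_kernel w x z.

Definition mu (w : edge G -> R) (alpha : R) (x z : V) : R :=
  if z == x then alpha else (1 - alpha) * balancing_kernel w x z.

Definition coupling (m n : V -> R) (c : V * V -> R) : Prop :=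
  [/\ forall q, 0 <= c q,
      forall u, \sum_(v : V) c (u, v) = m u
    & forall v, \sum_(u : V) c (u, v) = n v].

Definition W1 (m n : V -> R) : R :=
  inf [set \sum_(q : V * V) c q * dist q.1 q.2 | c in coupling m n].

Definition kappa_alpha (w : edge G -> R) (alpha : R) (x y : V) : R :=
  1 - W1 (mu w alpha x) (mu w alpha y) / dist x y.

Definition kappa (w : edge G -> R) (x y : V) : R :=
  lim (kappa_alpha w alpha x y / (1 - alpha) @[alpha --> 1^'-]).

Definition edge_kappa (w : edge G -> R) (e : edge G) : R :=
  kappa w (val e).1 (val e).2.

Definition ricci_rhs (w : edge G -> R) (e : edge G) : R :=
  - edge_kappa w e * w e + w e * \sum_(h : edge G) edge_kappa w h * w h.

(* Only the restriction of w to [0, +oo[ is meant, so the derivative at 0 is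
   the right derivative. *)
Definition ricci_flow_solution (w0 : edge G -> R) (w : R -> edge G -> R) : Prop :=
  [/\ forall (t : R) e, 0 <= t -> 0 < w t e,
      forall e, w 0 e = w0 e,
      forall (t : R) e, 0 < t ->
        is_derive t 1 (fun s => w s e) (ricci_rhs (w t) e)
    & forall e, (w s e - w 0 e) / s @[s --> 0^'+] --> ricci_rhs (w 0) e].

End Curvature.

(* Main.v *)
Require Import Defs.
From mathcomp Require Import all_boot all_order all_algebra.
From mathcomp Require Import all_classical all_reals all_analysis.
From mathcomp Require Import ring lra.

Import Order.TTheory GRing.Theory Num.Theory.
Import numFieldNormedType.Exports.

Local Open Scope classical_set_scope.
Local Open Scope ring_scope.

Set Implicit Arguments.
Unset Strict Implicit.
Unset Printing Implicit Defensive.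

(** Everything is done in the logarithmic coordinates p_e = ln w_e, in which
    the curvature is globally Lipschitz and bounded, so that the flow never
    meets the boundary of the positive orthant.

    The transition kernel is a convex combination of two softmax functions of
    p, and softmax is 2-Lipschitz for the sup norm ([normalize_lipschitz]).
    The Wasserstein distance is Lipschitz for total variation
    ([W1_tv_dist]).  Since mu^alpha differs from a Dirac mass, and the measures
    of two weights differ from one another, only by O(1 - alpha), the factor
    1 - alpha cancels in kappa_alpha / (1 - alpha): these quotients are bounded
    and Lipschitz in p uniformly in alpha.  They are nondecreasing in alpha,
    because W1 is convex along the segment from mu^alpha to the Dirac masses.
    Hence the limit defining the curvature exists, and it inherits the bound
    and the Lipschitz constant ([kappa_cvg], [kappa_bound],
    [kappa_lipschitz]).

    Existence.  The curvature does not change when all weights are multiplied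
    by the same factor.  So the normalisation term of the flow can be dropped:
    p_e' = - kappa_e (exp p) has a Lipschitz right-hand side, Picard iteration
    solves it for all times ([ode_existence]), and w = exp p / sum (exp p) solves
    the normalised flow ([ricci_rhs_normalized_exp]).

    Uniqueness.  The logarithms of two solutions both satisfy
    p_e' = - kappa_e + sum_h kappa_h exp p_h, whose right-hand side is Lipschitz
    where p is bounded above, in particular along the two solutions on a
    compact time interval ([ricci_flow_unique]).

    Both ODE arguments use the same estimate: in the norm weighted by
    exp (2 L t), integrating a quantity of at most L times the current
    error halves the error ([exponential_comparison]). *)

(** * Directed distance *)

Section Distance.
Context (R : realType) (V : finType) (G : rel V) (len : V -> V -> R).
Hypothesis len_gt0 : forall u v : V, G u v -> 0 < len u v.

Lemma path_length_ge0 x p : path G x p -> 0 <= path_length len x p.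
Proof.
rewrite /path_length; elim: p x => [|a p IHp] x /=; first by rewrite big_nil.
by case/andP=> Gxa /IHp le0p; rewrite big_cons addr_ge0 // ltW ?len_gt0.
Qed.

Lemma dist_set_lbound0 x y :
  lbound [set path_length len x p | p in [set p | dipath G x y p]] 0.
Proof. by move=> _ [p [Gp _ _] <-]; exact: path_length_ge0. Qed.

Lemma dist_ge0 x y : 0 <= dist G len x y.
Proof.
rewrite /dist; set S := (X in inf X).
have [->|/set0P S0] := eqVneq S set0; first by rewrite inf0.
exact: lb_le_inf S0 (@dist_set_lbound0 x y).
Qed.

(** There are finitely many edges, so their lengths have a positive lower
    bound, and a path between distinct vertices has at least one edge. *)
Lemma dist_gt0 x y : x != y -> G x y -> 0 < dist G len x y.
Proof.
move=> neq_xy Gxy; pose l0 := \big[Num.min/1]_(e : edge G) len (val e).1 (val e).2.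
have l0_gt0 : 0 < l0.
  by apply/bigmin_gtP; split=> // -[e Ge] _; exact: len_gt0.
have l0_le u v : G u v -> l0 <= len u v.
  move=> Guv; pose e : edge G := Sub (u, v) Guv.
  exact: (bigmin_le _ e (fun e : edge G => len (val e).1 (val e).2)).
apply: lt_le_trans l0_gt0 _; apply: lb_le_inf.
  (* An infimum over the empty set would be 0; the edge itself is a path. *)
  exists (path_length len x [:: y]), [:: y] => //.
  by split; rewrite //= ?Gxy ?inE ?neq_xy.
move=> _ [[|a p] [/= Gp lastp _] <-]; first by rewrite lastp eqxx in neq_xy.
case/andP: Gp => Gxa Gp; rewrite /path_length /= big_cons.
by rewrite -[l0]addr0 lerD ?l0_le ?path_length_ge0.
Qed.

End Distance.

(** * Transport cost and total variation *)

Section Transport.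
Context (R : realType) (V : finType) (G : rel V) (len : V -> V -> R).
Hypothesis len_gt0 : forall u v : V, G u v -> 0 < len u v.
Local Notation d := (dist G len).
Local Notation W1 := (W1 G len).

Definition prob_vector (m : V -> R) := (forall u, 0 <= m u) /\ \sum_u m u = 1.

Definition dirac_at (x : V) : V -> R := fun z => (z == x)%:R.

(** A crude but uniform bound for the distance of any two vertices. *)
Definition total_dist : R := \sum_(q : V * V) d q.1 q.2.

Definition cost (c : V * V -> R) : R := \sum_(q : V * V) c q * d q.1 q.2.

Lemma total_dist_ge0 : 0 <= total_dist.
Proof. by apply: sumr_ge0 => q _; exact: dist_ge0. Qed.

Lemma dist_le_total u v : d u v <= total_dist.
Proof.
rewrite /total_dist (bigD1 (u, v)) //= lerDl.
by apply: sumr_ge0 => q _; exact: dist_ge0.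
Qed.

Lemma cost_ge0 c : (forall q, 0 <= c q) -> 0 <= cost c.
Proof. by move=> c0; apply: sumr_ge0 => q _; rewrite mulr_ge0 ?dist_ge0. Qed.

Lemma W1_le m n c : coupling m n c -> W1 m n <= cost c.
Proof.
move=> cc; apply: ge_inf; last by exists c.
by exists 0 => _ [c' [c0 _ _] <-]; exact: cost_ge0.
Qed.

Lemma le_W1 m n (B : R) : prob_vector m -> prob_vector n ->
  (forall c, coupling m n c -> B <= cost c) -> B <= W1 m n.
Proof.
move=> [m0 m1] [n0 n1] leB; apply: lb_le_inf; last by move=> _ [c cc <-]; exact: leB.
exists (cost (fun q => m q.1 * n q.2)), (fun q => m q.1 * n q.2) => //.
split=> [q|u|v] /=; first by rewrite mulr_ge0.
  by rewrite -mulr_sumr n1 mulr1.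
by rewrite -mulr_suml m1 mul1r.
Qed.

Lemma cost_mix (s t : R) c c' :
  cost (fun q => s * c q + t * c' q) = s * cost c + t * cost c'.
Proof.
rewrite /cost !mulr_sumr -big_split; apply: eq_bigr => q _ /=.
by rewrite mulrDl !mulrA.
Qed.

Lemma cost_atom x y : cost (fun q => (q == (x, y))%:R) = d x y.
Proof.
rewrite /cost (bigD1 (x, y)) //= eqxx mul1r big1 ?addr0 // => q /negPf ->.
by rewrite mul0r.
Qed.

Lemma coupling_atom x y :
  coupling (dirac_at x) (dirac_at y) (fun q => (q == (x, y))%:R).
Proof.
split=> [q|u|v]; first exact: ler0n.
- under eq_bigr => v _ do rewrite xpair_eqE.
  rewrite (bigD1 y) //= eqxx andbT big1 ?addr0 // => v /negPf ->.
  by rewrite andbF.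
- under eq_bigr => u _ do rewrite xpair_eqE.
  rewrite (bigD1 x) //= eqxx /= big1 ?addr0 // => u /negPf ->.
  by [].
Qed.

Lemma dirac_prob_vector x : prob_vector (dirac_at x).
Proof.
split=> [u|]; first exact: ler0n.
by rewrite (bigD1 x) //= /dirac_at eqxx big1 ?addr0 // => u /negPf ->.
Qed.

(** A coupling of two Dirac masses is itself a Dirac mass. *)
Lemma W1_dirac x y : W1 (dirac_at x) (dirac_at y) = d x y.
Proof.
apply: le_anti; rewrite -{1}cost_atom W1_le /=; last exact: coupling_atom.
apply: le_W1 => [||c [c0 c1 c2]]; try exact: dirac_prob_vector.
have c_row0 u v : u != x -> c (u, v) = 0.
  move=> /negPf ux; have := c1 u; rewrite /dirac_at ux /=.
  by move/psumr_eq0P => ->.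
have c_col0 u v : v != y -> c (u, v) = 0.
  move=> /negPf vy; have := c2 v; rewrite /dirac_at vy /=.
  by move/psumr_eq0P => ->.
have cxy : c (x, y) = 1.
  have := c1 x; rewrite (bigD1 y) //= big1 ?addr0 /dirac_at ?eqxx // => v.
  exact: c_col0.
rewrite /cost (bigD1 (x, y)) //= cxy mul1r lerDl; apply: sumr_ge0 => q _.
by rewrite mulr_ge0 ?dist_ge0.
Qed.

(** Mixing a coupling with the atom at (x, y) couples the mixtures.  This
    convexity is what makes kappa_alpha / (1 - alpha) monotone in alpha. *)
Lemma W1_mix_dirac (s : R) x y m n : 0 < s <= 1 ->
  prob_vector m -> prob_vector n ->
  W1 (fun z => s * m z + (1 - s) * dirac_at x z)
     (fun z => s * n z + (1 - s) * dirac_at y z)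
    <= s * W1 m n + (1 - s) * d x y.
Proof.
case/andP=> s0 s1 dm dn; rewrite -lerBlDr -ler_pdivrMl //.
apply: le_W1 => // c [c0 c1 c2]; rewrite ler_pdivrMl // lerBlDr.
have [a0 a1 a2] := coupling_atom x y.
rewrite -cost_atom -cost_mix; apply: W1_le; split=> [q|u|v].
- by rewrite addr_ge0 ?mulr_ge0 ?subr_ge0 // ltW.
- by rewrite big_split /= -!mulr_sumr c1 a1.
- by rewrite big_split /= -!mulr_sumr c2 a2.
Qed.

(** A coupling c of m and n is turned into one of m' and n' as follows.  Row u
    is scaled by min (m u) (m' u) / m u and column v similarly, so that the
    marginals drop below m' and n'; the mass thus lost is at most the total
    variation, and it is put back as a product measure at a cost of at most
    [total_dist] per unit. *)
Lemma W1_tv m n m' n' : prob_vector m -> prob_vector n ->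
  prob_vector m' -> prob_vector n' ->
  W1 m' n' <= W1 m n +
    total_dist * (\sum_u `|m u - m' u| + \sum_v `|n v - n' v|).
Proof.
move=> dm dn [m'0 m'1] [n'0 n'1]; rewrite -lerBlDr.
apply: le_W1 => // c [c0 c1 c2]; rewrite lerBlDr.
case: dm dn => m0 m1 [n0 n1].
pose r u := Num.min (m u) (m' u) / m u.
pose s v := Num.min (n v) (n' v) / n v.
have shrink (a b : R) : 0 <= a -> 0 <= b ->
    [/\ 0 <= Num.min a b / a, Num.min a b / a <= 1 &
        a * (Num.min a b / a) = Num.min a b].
  rewrite le_eqVlt => /predU1P[<-|a0] b0.
    by rewrite invr0 mulr0 mul0r; split=> //; rewrite min_l.
  split; first by apply: divr_ge0; rewrite ?le_min ?b0 ltW.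
    by rewrite ler_pdivrMr // mul1r ge_min lexx.
  by rewrite mulrC divfK ?gt_eqF.
(* Where m u = 0 the quotient is 0 by convention, and m u * r u is still the
   minimum. *)
have rP u := shrink _ _ (m0 u) (m'0 u); have sP v := shrink _ _ (n0 v) (n'0 v).
have r0 u : 0 <= r u by case: (rP u).
have r1 u : r u <= 1 by case: (rP u).
have s0 v : 0 <= s v by case: (sP v).
have s1 v : s v <= 1 by case: (sP v).
have mr u : m u * r u = Num.min (m u) (m' u) by case: (rP u).
have ns v : n v * s v = Num.min (n v) (n' v) by case: (sP v).
pose k (q : V * V) := c q * (r q.1 * s q.2).
have k0 q : 0 <= k q by apply: mulr_ge0 => //; exact: mulr_ge0.
have kc q : k q <= c q by rewrite ler_piMr //; exact: mulr_ile1.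
pose a u := m' u - \sum_v k (u, v).
pose b v := n' v - \sum_u k (u, v).
have a0 u : 0 <= a u.
  rewrite subr_ge0; apply: (@le_trans _ _ (m u * r u)); last first.
    by rewrite mr ge_min lexx orbT.
  rewrite -c1 mulr_suml ler_sum // => v _; rewrite /k /=.
  by rewrite ler_wpM2l // ler_piMr.
have b0 v : 0 <= b v.
  rewrite subr_ge0; apply: (@le_trans _ _ (n v * s v)); last first.
    by rewrite ns ge_min lexx orbT.
  rewrite -c2 mulr_suml ler_sum // => u _; rewrite /k /=.
  by rewrite ler_wpM2l // ler_piMl.
(* The deficits a and b of the two marginals have the same total mass t. *)
pose t := 1 - \sum_q k q.
have sumE f : \sum_(q : V * V) f q = \sum_u \sum_v f (u, v) :> R.
  by rewrite pair_bigA; apply: eq_bigr => -[].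
have suma : \sum_u a u = t by rewrite sumrB m'1 -sumE.
have sumb : \sum_v b v = t by rewrite sumrB n'1 exchange_big -sumE.
have t0 : 0 <= t by rewrite -suma sumr_ge0.
have t_le : t <= \sum_u `|m u - m' u| + \sum_v `|n v - n' v|.
  have -> : t = \sum_q (c q - k q).
    by rewrite sumrB sumE; congr (_ - _); rewrite -m1; apply: eq_bigr => u _.
  apply: (@le_trans _ _ (\sum_q (c q * (1 - r q.1) + c q * (1 - s q.2)))).
    apply: ler_sum => q _; rewrite -mulrDr /k -[X in X - _]mulr1 -mulrBr.
    rewrite ler_wpM2l //; have := r0 q.1; have := s0 q.2.
    have := r1 q.1; have := s1 q.2; nra.
  have le_norm (x y : R) : x - Num.min x y <= `|x - y|.
    by case: (lerP x y) => xy //; rewrite subrr subr_ge0.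
  rewrite big_split /= lerD // sumE; last rewrite exchange_big /=.
    apply: ler_sum => u _ /=; rewrite -mulr_suml c1 mulrBr mulr1 mr; exact: le_norm.
  apply: ler_sum => v _ /=; rewrite -mulr_suml c2 mulrBr mulr1 ns; exact: le_norm.
(* If t = 0 both deficits vanish, and so does the added product measure. *)
pose c' q := k q + t^-1 * (a q.1 * b q.2).
have e0 q : 0 <= t^-1 * (a q.1 * b q.2) by rewrite !mulr_ge0 ?invr_ge0.
have sum_e1 u : \sum_v t^-1 * (a u * b v) = a u.
  rewrite -!mulr_sumr sumb mulrCA.
  have [t_eq0|?] := eqVneq t 0; last by rewrite mulVf ?mulr1.
  by have := suma; rewrite t_eq0 => /psumr_eq0P ->//; rewrite mul0r.
have sum_e2 v : \sum_u t^-1 * (a u * b v) = b v.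
  rewrite -mulr_sumr -mulr_suml suma; have [t_eq0|?] := eqVneq t 0; last by rewrite mulKf.
  by have := sumb; rewrite t_eq0 => /psumr_eq0P ->//; rewrite !mulr0.
have cc' : coupling m' n' c'.
  split=> [q|u|v]; first by rewrite addr_ge0.
    by rewrite big_split /= sum_e1 addrC subrK.
  by rewrite big_split /= sum_e2 addrC subrK.
apply: (le_trans (W1_le cc')).
have -> : cost c' = cost k + cost (fun q => t^-1 * (a q.1 * b q.2)).
  by rewrite /cost -big_split; apply: eq_bigr => q _ /=; rewrite -mulrDl.
apply: lerD.
  by apply: ler_sum => q _; rewrite ler_wpM2r ?dist_ge0.
apply: (@le_trans _ _ (total_dist * t)); last first.
  by rewrite ler_wpM2l ?total_dist_ge0.
have -> : total_dist * t = \sum_q t^-1 * (a q.1 * b q.2) * total_dist.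
  rewrite -mulr_suml sumE mulrC -[X in X * _ = _]suma; congr (_ * _).
  by apply: eq_bigr => u _; rewrite -[LHS]sum_e1.
by apply: ler_sum => q _; rewrite ler_wpM2l ?dist_le_total.
Qed.

Lemma W1_tv_dist m n m' n' : prob_vector m -> prob_vector n ->
  prob_vector m' -> prob_vector n' ->
  `|W1 m n - W1 m' n'| <=
    total_dist * (\sum_u `|m u - m' u| + \sum_v `|n v - n' v|).
Proof.
move=> dm dn dm' dn'; rewrite distrC ler_distl W1_tv //= andbT lerBlDr.
have sumC (f g : V -> R) : \sum_u `|f u - g u| = \sum_u `|g u - f u|.
  by apply: eq_bigr => u _; rewrite distrC.
by have := W1_tv dm' dn' dm dn; rewrite (sumC m') (sumC n').
Qed.

End Transport.

(** * The balancing kernel in logarithmic coordinates *)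

(** Numerator and denominator each change by a factor of at most e^B, so the
    quotient p satisfies q >= e^(-2B) p >= (1 - 2B) p, and p <= 1. *)
Lemma normalize_le (R : realType) (I : finType) (P : pred I) (a b : I -> R) B i :
    0 <= B -> (forall j, P j -> 0 < a j) -> (forall j, P j -> 0 < b j) ->
    (forall j, P j -> a j <= expR B * b j) ->
    (forall j, P j -> b j <= expR B * a j) -> P i ->
  a i / (\sum_(j | P j) a j) - b i / (\sum_(j | P j) b j) <= 2 * B.
Proof.
move=> B0 a0 b0 leab leba Pi.
have sum_gt0 (c : I -> R) : (forall j, P j -> 0 < c j) -> 0 < \sum_(j | P j) c j.
  move=> c0; rewrite (bigD1 i) //= ltr_pwDl ?c0 // sumr_ge0 // => j /andP[Pj _].
  exact/ltW/c0.
set A := \sum_(j | P j) a j; set C := \sum_(j | P j) b j.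
have A0 : 0 < A by exact: sum_gt0.
have C0 : 0 < C by exact: sum_gt0.
have leCA : C <= expR B * A by rewrite mulr_sumr; exact: ler_sum.
have p1 : a i / A <= 1.
  rewrite ler_pdivrMr // mul1r /A (bigD1 i) //= lerDl sumr_ge0 // => j /andP[Pj _].
  exact/ltW/a0.
have p0 : 0 <= a i / A by rewrite divr_ge0 // ltW // a0.
have leq : expR (- (2 * B)) * (a i / A) <= b i / C.
  rewrite ler_pdivlMr //.
  apply: (@le_trans _ _ (expR (- (2 * B)) * (a i / A) * (expR B * A))).
    by rewrite ler_wpM2l // mulr_ge0 // expR_ge0.
  have -> : expR (- (2 * B)) * (a i / A) * (expR B * A) = expR (- B) * a i.
    have -> : expR (- B) = expR (- (2 * B)) * expR B.
      by rewrite -expRD; congr expR; ring.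
    by field; rewrite gt_eqF.
  by rewrite expRN ler_pdivrMl ?expR_gt0 // leab.
have := expR_ge1Dx (- (2 * B)); nra.
Qed.

Lemma normalize_lipschitz (R : realType) (I : finType) (P : pred I) (a b : I -> R) B i :
    0 <= B -> (forall j, P j -> 0 < a j) -> (forall j, P j -> 0 < b j) ->
    (forall j, P j -> a j <= expR B * b j) ->
    (forall j, P j -> b j <= expR B * a j) -> P i ->
  `|a i / (\sum_(j | P j) a j) - b i / (\sum_(j | P j) b j)| <= 2 * B.
Proof.
move=> B0 a0 b0 leab leba Pi.
by rewrite ler_norml lerNl opprB !normalize_le.
Qed.

Section Kernel.
Context (R : realType) (V : finType) (G : rel V).
Implicit Types (w : edge G -> R) (x y u v : V).

Lemma weight_edge w x u (Gxu : G x u) : weight w x u = w (Sub (x, u) Gxu).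
Proof. by rewrite /weight insubT. Qed.

Lemma weight_gt0 w x u : (forall e, 0 < w e) -> G x u -> 0 < weight w x u.
Proof. by move=> w0 Gxu; rewrite weight_edge. Qed.

Lemma weight_scale w (k : R) x u : weight (fun e => k * w e) x u = k * weight w x u.
Proof. by rewrite /weight; case: insub => [e|] //; rewrite mulr0. Qed.

Lemma out_sum_gt0 w x : (forall e, 0 < w e) -> (exists u, G x u) ->
  0 < \sum_(u | G x u) weight w x u.
Proof.
move=> w0 [u Gxu]; rewrite (bigD1 u) //= ltr_pwDl ?weight_gt0 // sumr_ge0 //.
by move=> v /andP[Gxv _]; rewrite ltW ?weight_gt0.
Qed.

Lemma in_sum_gt0 w x : (forall e, 0 < w e) -> (exists u, G u x) ->
  0 < \sum_(u | G u x) weight w u x.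
Proof.
move=> w0 [u Gux]; rewrite (bigD1 u) //= ltr_pwDl ?weight_gt0 // sumr_ge0 //.
by move=> v /andP[Gvx _]; rewrite ltW ?weight_gt0.
Qed.

Context (beta : V -> R).
Hypothesis beta01 : forall x, 0 <= beta x <= 1.
Local Notation kernel := (balancing_kernel beta).

Lemma kernel_scale w (k : R) : 0 < k ->
  kernel (fun e => k * w e) = kernel w.
Proof.
move=> k0; apply/funext => x; apply/funext => z.
have scale_div (a b : R) : k * a / (k * b) = a / b.
  by rewrite invfM mulrACA mulfV ?mul1r ?gt_eqF.
have sum_scale (P : pred V) (f : V -> V * V) :
    \sum_(u | P u) weight (fun e => k * w e) (f u).1 (f u).2
      = k * \sum_(u | P u) weight w (f u).1 (f u).2.
  by rewrite mulr_sumr; apply: eq_bigr => u _; rewrite weight_scale.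
rewrite /balancing_kernel /out_kernel /in_kernel !weight_scale.
by rewrite (sum_scale _ (pair x)) (sum_scale _ (pair^~ x)) !scale_div.
Qed.

Lemma kernel_ge0 w x z : (forall e, 0 < w e) -> 0 <= kernel w x z.
Proof.
move=> w0; have /andP[b0 b1] := beta01 x.
have sum_ge0 (P : pred V) f : (forall u, P u -> 0 < f u) -> 0 <= \sum_(u | P u) f u :> R.
  by move=> f0; apply: sumr_ge0 => u /f0/ltW.
apply: addr_ge0; apply: mulr_ge0; rewrite ?subr_ge0 //.
  rewrite /out_kernel; case: ifP => // Gxz; rewrite divr_ge0 ?sum_ge0 ?ltW ?weight_gt0 //.
  by move=> u; exact: weight_gt0.
rewrite /in_kernel; case: ifP => // Gxz; rewrite divr_ge0 ?sum_ge0 ?ltW ?weight_gt0 //.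
by move=> u; exact: weight_gt0.
Qed.

Lemma kernel_sum1 w x : (forall e, 0 < w e) ->
  (exists u, G x u) -> (exists u, G u x) -> \sum_z kernel w x z = 1.
Proof.
move=> w0 hout hin; rewrite big_split /= -!mulr_sumr.
rewrite /out_kernel -big_mkcond -mulr_suml mulfV ?gt_eqF ?out_sum_gt0 //.
rewrite /in_kernel -big_mkcond -mulr_suml mulfV ?gt_eqF ?in_sum_gt0 //.
by rewrite !mulr1 addrC subrK.
Qed.

Lemma kernel_le1 w x z : (forall e, 0 < w e) ->
  (exists u, G x u) -> (exists u, G u x) -> kernel w x z <= 1.
Proof.
move=> w0 hout hin; rewrite -(kernel_sum1 w0 hout hin) (bigD1 z) //= lerDl.
by apply: sumr_ge0 => u _; exact: kernel_ge0.
Qed.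

Lemma kernel_diag w x : irreflexive G -> kernel w x x = 0.
Proof.
by move=> Girr; rewrite /balancing_kernel /out_kernel /in_kernel Girr !mulr0 addr0.
Qed.

(** In the coordinates p = ln w the Lipschitz constant holds on the whole
    space, although w itself may approach 0. *)
Lemma kernel_lipschitz (p q : edge G -> R) (B : R) x z :
  0 <= B -> (forall e, `|p e - q e| <= B) ->
  `|kernel (expR \o p) x z - kernel (expR \o q) x z| <= 2 * B.
Proof.
move=> B0 pqB; have /andP[b0 b1] := beta01 x.
have cmp (r s : edge G -> R) u v : (forall e, `|r e - s e| <= B) -> G u v ->
    weight (expR \o r) u v <= expR B * weight (expR \o s) u v.
  move=> rsB Guv; rewrite !weight_edge /= -expRD ler_expR -lerBlDr.
  exact: le_trans (ler_norm _) (rsB _).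
have qpB e : `|q e - p e| <= B by rewrite distrC.
have out_le : `|out_kernel (expR \o p) x z - out_kernel (expR \o q) x z| <= 2 * B.
  rewrite /out_kernel; case: ifP => [Gxz|_]; last by rewrite subrr normr0 mulr_ge0.
  apply: (@normalize_lipschitz _ _ (G x)) => // u Gxu; try exact: cmp;
    by apply: weight_gt0 => // e; exact: expR_gt0.
have in_le : `|in_kernel (expR \o p) x z - in_kernel (expR \o q) x z| <= 2 * B.
  rewrite /in_kernel; case: ifP => [Gxz|_]; last by rewrite subrr normr0 mulr_ge0.
  apply: (@normalize_lipschitz _ _ (G^~ x) (fun u => weight (expR \o p) u x)
    (fun u => weight (expR \o q) u x)) => // u Gxu; try exact: cmp;
    by apply: weight_gt0 => // e; exact: expR_gt0.
rewrite /balancing_kernel; move: out_le in_le.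
set a := out_kernel _ _ _; set a' := out_kernel _ _ _.
set b := in_kernel _ _ _; set b' := in_kernel _ _ _.
rewrite !ler_norml => /andP[? ?] /andP[? ?]; apply/andP; split; nra.
Qed.

End Kernel.

(** * Lin-Lu-Yau curvature of an edge *)

(** Without an out-neighbour and an in-neighbour the balancing kernel at x would
    not have total mass 1. *)
Lemma strongly_connected_neighbors (V : finType) (G : rel V) x y :
  strongly_connected G -> x != y -> (exists u, G x u) /\ (exists u, G u x).
Proof.
move=> Gsc neq_xy; split.
  have [[|u p] [/= Gp lastp _]] := Gsc x y neq_xy.
    by rewrite lastp eqxx in neq_xy.
  by case/andP: Gp => Gxu _; exists u.
rewrite eq_sym in neq_xy; have [p [Gp lastp _]] := Gsc y x neq_xy.
case/lastP: p => [|p u] in Gp lastp *.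
  by rewrite /= in lastp; rewrite lastp eqxx in neq_xy.
rewrite rcons_path last_rcons in Gp lastp *; case/andP: Gp => _ Gu.
by exists (last y p); rewrite -lastp.
Qed.

Section Curvature.
Context (R : realType) (V : finType) (G : rel V).
Hypotheses (G_loopless : irreflexive G) (G_sc : strongly_connected G).
Context (len : V -> V -> R).
Hypothesis len_gt0 : forall u v : V, G u v -> 0 < len u v.
Context (beta : V -> R).
Hypothesis beta01 : forall x : V, 0 <= beta x <= 1.
Local Notation d := (dist G len).
Local Notation mu := (mu beta).
Local Notation D := (total_dist G len).
Local Notation N := (#|V|%:R : R).
Implicit Type w : edge G -> R.

Section Measures.
Variables (x y : V) (neq_xy : x != y).

Lemma mu_prob_vector w (a : R) : (forall e : edge G, 0 < w e) -> 0 <= a <= 1 ->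
  prob_vector (mu w a x).
Proof.
move=> w0 /andP[a0 a1]; have [hout hin] := strongly_connected_neighbors G_sc neq_xy.
split=> [u|].
  by rewrite /Defs.mu; case: ifP => // _; rewrite mulr_ge0 ?subr_ge0 ?kernel_ge0.
rewrite (bigD1 x) //= /Defs.mu eqxx.
rewrite (eq_bigr (fun z => (1 - a) * balancing_kernel beta w x z)); last first.
  by move=> z /negPf ->.
have := kernel_sum1 beta w0 hout hin.
rewrite (bigD1 x) //= kernel_diag // add0r -mulr_sumr => ->.
by rewrite mulr1 addrC subrK.
Qed.

Lemma mu_sub_dirac w (a : R) : (forall e : edge G, 0 < w e) -> 0 <= a <= 1 ->
  \sum_z `|mu w a x z - dirac_at R x z| <= (1 - a) * N.
Proof.
move=> w0 /andP[a0 a1]; have [hout hin] := strongly_connected_neighbors G_sc neq_xy.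
rewrite mulr_natr -sumr_const; apply: ler_sum => z _.
rewrite /Defs.mu /dirac_at; case: ifP => _ /=.
  by rewrite distrC ger0_norm // subr_ge0.
rewrite subr0 ger0_norm; last by rewrite mulr_ge0 ?subr_ge0 ?kernel_ge0.
by rewrite ler_piMr ?subr_ge0 ?kernel_le1.
Qed.

Lemma mu_lipschitz (p q : edge G -> R) (B a : R) : 0 <= B -> a <= 1 ->
  (forall e, `|p e - q e| <= B) ->
  \sum_z `|mu (expR \o p) a x z - mu (expR \o q) a x z| <= (1 - a) * (N * (2 * B)).
Proof.
move=> B0 a1 pqB; rewrite mulrCA mulrC mulr_natr -sumr_const; apply: ler_sum => z _.
rewrite /Defs.mu; case: ifP => _ /=.
  by rewrite subrr normr0 !mulr_ge0 ?subr_ge0.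
rewrite -mulrBr normrM ger0_norm ?subr_ge0 // ler_wpM2l ?subr_ge0 //.
exact: kernel_lipschitz.
Qed.

(** As alpha increases to 1, the measure moves on a straight line towards the
    Dirac mass. *)
Lemma mu_segment w (s a : R) z :
  mu w (1 - s * (1 - a)) x z = s * mu w a x z + (1 - s) * dirac_at R x z.
Proof. by rewrite /Defs.mu /dirac_at; case: ifP => _ /=; ring. Qed.

End Measures.

Section Edge.
Variables (x y : V) (Gxy : G x y).

Let neq_xy : x != y.
Proof. by apply: contraTneq Gxy => ->; rewrite G_loopless. Qed.

Let neq_yx : y != x. Proof. by rewrite eq_sym. Qed.

Let d_gt0 : 0 < d x y. Proof. exact: dist_gt0. Qed.

Local Notation quotient w a := (kappa_alpha len beta w a x y / (1 - a)).

Let quotientE w a : a < 1 -> quotient w a =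
  (d x y - W1 G len (mu w a x) (mu w a y)) / (d x y * (1 - a)).
Proof.
move=> a1; rewrite /kappa_alpha; field.
by rewrite subr_eq0 gt_eqF // gt_eqF.
Qed.

(** Each of the two measures is within (1 - alpha) #|V| of a Dirac mass in
    total variation, which moves W1 by at most D (2 #|V|) per unit of
    1 - alpha. *)
Definition curvature_bound : R := D * (2 * N) / d x y.

(** The numerator is the difference of W1 at the Dirac masses and at the
    measures, whose total variation distance is O(1 - alpha). *)
Lemma quotient_bound w a : (forall e, 0 < w e) -> 0 <= a < 1 ->
  `|quotient w a| <= curvature_bound.
Proof.
move=> w0 /andP[a0 a1]; have a01 : 0 <= a <= 1 by rewrite a0 ltW.
have a1' : 0 < 1 - a by rewrite subr_gt0.
have := W1_tv_dist len_gt0 (mu_prob_vector neq_xy w0 a01)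
  (mu_prob_vector neq_yx w0 a01) (dirac_prob_vector R x) (dirac_prob_vector R y).
rewrite W1_dirac // => le_tv; rewrite quotientE // normrM normfV.
rewrite (ger0_norm (ltW (mulr_gt0 d_gt0 a1'))) ler_pdivrMr ?mulr_gt0 // distrC.
apply: (le_trans le_tv).
have -> : curvature_bound * (d x y * (1 - a)) = D * ((1 - a) * N + (1 - a) * N).
  by rewrite /curvature_bound; field; rewrite gt_eqF.
rewrite ler_wpM2l ?total_dist_ge0 //.
exact: lerD (mu_sub_dirac neq_xy w0 a01) (mu_sub_dirac neq_yx w0 a01).
Qed.

Lemma quotient_homo w a b : (forall e, 0 < w e) -> 0 <= a -> a <= b -> b < 1 ->
  quotient w a <= quotient w b.
Proof.
move=> w0 a0 ab b1; have a1 : a < 1 by exact: le_lt_trans b1.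
have a1' : 0 < 1 - a by rewrite subr_gt0.
have b1' : 0 < 1 - b by rewrite subr_gt0.
pose s := (1 - b) / (1 - a).
have s01 : 0 < s <= 1 by rewrite divr_gt0 //= ler_pdivrMr // mul1r lerB.
have a01 : 0 <= a <= 1 by rewrite a0 ltW.
have bE : b = 1 - s * (1 - a) by rewrite divfK ?gt_eqF // opprB addrC subrK.
have mubE z : mu w b z = fun u => s * mu w a z u + (1 - s) * dirac_at R z u.
  by apply/funext => u; rewrite bE mu_segment.
have := W1_mix_dirac len_gt0 x y s01
  (mu_prob_vector neq_xy w0 a01) (mu_prob_vector neq_yx w0 a01).
rewrite -!mubE !quotientE // => le_mix.
have -> : d x y * (1 - b) = s * (d x y * (1 - a)) by rewrite {1}bE; ring.
case/andP: s01 => s0 s1.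
have : 0 < d x y * (1 - a) by exact: mulr_gt0.
move: (d x y * (1 - a)) => E E0.
rewrite [(s * E)^-1]invfM mulrA ler_pM2r ?invr_gt0 // ler_pdivlMr //.
by lra.
Qed.

Lemma kappa_cvg w : (forall e, 0 < w e) ->
  quotient w a @[a --> 1^'-] --> kappa len beta w x y.
Proof.
move=> w0; apply: nondecreasing_at_left_is_cvgr.
  near=> c => a b.
  have c0 : 0 <= c by near: c; apply: nbhs_left_ge; exact: ltr01.
  rewrite !in_itv /= => /andP[ca a1] /andP[cb b1] ab.
  exact: quotient_homo w0 (le_trans c0 (ltW ca)) ab b1.
near=> c; have c0 : 0 <= c by near: c; apply: nbhs_left_ge; exact: ltr01.
exists curvature_bound => _ [a /= + <-]; rewrite in_itv /= => /andP[ca a1].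
apply: le_trans (ler_norm _) (quotient_bound w0 _).
by rewrite a1 (le_trans c0 (ltW ca)).
Unshelve. all: by end_near. Qed.

Lemma kappa_bound w : (forall e, 0 < w e) -> `|kappa len beta w x y| <= curvature_bound.
Proof.
move=> w0; have /cvg_norm cvgk := kappa_cvg w0.
rewrite -(cvg_lim _ cvgk) //; apply: limr_le.
  by apply/cvg_ex; exists `|kappa len beta w x y|.
near=> a.
have a1 : a < 1 by near: a; exact: nbhs_left_lt.
have a0 : 0 <= a by near: a; apply: nbhs_left_ge; exact: ltr01.
by apply: quotient_bound => //; rewrite a0.
Unshelve. all: by end_near. Qed.

(** The two measures at each end differ by O(1 - alpha) times the difference of
    the kernels, so the estimate is uniform in alpha and passes to the limit. *)
Lemma kappa_lipschitz (p q : edge G -> R) (B : R) :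
  (forall e, `|p e - q e| <= B) ->
  `|kappa len beta (expR \o p) x y - kappa len beta (expR \o q) x y|
    <= 2 * curvature_bound * B.
Proof.
move=> pqB.
have B0 : 0 <= B by exact: le_trans (pqB (Sub (x, y) Gxy : edge G)).
have w0 (r : edge G -> R) e : 0 < (expR \o r) e by exact: expR_gt0.
have cvgk : `|quotient (expR \o p) a - quotient (expR \o q) a| @[a --> 1^'-] -->
    `|kappa len beta (expR \o p) x y - kappa len beta (expR \o q) x y|.
  by apply: cvg_norm; apply: cvgB; exact: kappa_cvg.
rewrite -(cvg_lim _ cvgk) //; apply: limr_le.
  by apply/cvg_ex; eexists; exact: cvgk.
near=> a => /=.
have a1 : a < 1 by near: a; exact: nbhs_left_lt.
have a0 : 0 <= a by near: a; apply: nbhs_left_ge; exact: ltr01.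
have a01 : 0 <= a <= 1 by rewrite a0 ltW.
have a1' : 0 < 1 - a by rewrite subr_gt0.
have := W1_tv_dist len_gt0 (mu_prob_vector neq_xy (w0 q) a01)
  (mu_prob_vector neq_yx (w0 q) a01)
  (mu_prob_vector neq_xy (w0 p) a01) (mu_prob_vector neq_yx (w0 p) a01).
move=> le_tv; rewrite !quotientE // -mulrBl normrM normfV.
rewrite (ger0_norm (ltW (mulr_gt0 d_gt0 a1'))) ler_pdivrMr ?mulr_gt0 //.
rewrite opprB addrC addrA subrK.
apply: (le_trans le_tv).
have -> : 2 * curvature_bound * B * (d x y * (1 - a)) =
    D * ((1 - a) * (N * (2 * B)) + (1 - a) * (N * (2 * B))).
  by rewrite /curvature_bound; field; rewrite gt_eqF.
rewrite ler_wpM2l ?total_dist_ge0 //.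
by apply: lerD; apply: mu_lipschitz => //; rewrite ?ltW // => e; rewrite distrC.
Unshelve. all: by end_near. Qed.

Lemma kappa_scale w (k : R) : 0 < k ->
  kappa len beta (fun e => k * w e) x y = kappa len beta w x y.
Proof.
by move=> k0; rewrite /kappa /kappa_alpha /Defs.mu kernel_scale.
Qed.

End Edge.

End Curvature.

(** * Weighted estimates for ordinary differential equations *)

Section GeometricConvergence.
Context (R : realType).
Implicit Types (u : nat -> R) (K x : R).

Lemma cvg_div_expn2 K : K / 2 ^+ n @[n --> \oo] --> (0 : R).
Proof.
have half1 : `|2^-1 : R| < 1 by rewrite ger0_norm; lra.
by under eq_fun do rewrite -exprVn; exact: cvg_geometric half1.
Qed.

Lemma le0_div_expn2 x K : (forall n : nat, x <= K / 2 ^+ n) -> x <= 0.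
Proof.
move=> lexK; rewrite -(cvg_lim _ (@cvg_div_expn2 K)) //.
apply: limr_ge; first by apply/cvg_ex; exists 0; exact: cvg_div_expn2.
by apply: nearW => n; exact: lexK.
Qed.

Let geometric_lower u K : (forall n, `|u n.+1 - u n| <= K / 2 ^+ n) ->
  nondecreasing_seq (fun n => u n - 2 * K / 2 ^+ n).
Proof.
move=> uK; apply/nondecreasing_seqP => n.
have := uK n; rewrite ler_norml => /andP[+ _].
have -> : 2 * K / 2 ^+ n.+1 = K / 2 ^+ n :> R.
  by rewrite exprS invfM; field; rewrite expf_neq0.
by rewrite -[2 * K / _]mulrA; lra.
Qed.

(** u n - 2K / 2^n is nondecreasing and u n + 2K / 2^n is nonincreasing, hence
    both bracket the limit. *)
Lemma geometric_cvg u K : (forall n, `|u n.+1 - u n| <= K / 2 ^+ n) ->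
  forall n, `|limn u - u n| <= 2 * K / 2 ^+ n.
Proof.
move=> uK; have nuK n : `|- u n.+1 - - u n| <= K / 2 ^+ n.
  by rewrite -opprD normrN.
have lo := geometric_lower uK.
have hi := @geometric_lower (fun n => - u n) K nuK.
have K0 : 0 <= K by have := le_trans (normr_ge0 _) (uK 0); rewrite expr0 divr1.
have e0 n : 0 <= 2 * K / 2 ^+ n :> R by rewrite !mulr_ge0 // invr_ge0 exprn_ge0.
have cvg_lo : cvgn (fun n => u n - 2 * K / 2 ^+ n).
  apply: nondecreasing_is_cvgn => //; exists (u 0 + 2 * K) => _ [n _ <-].
  have := hi 0 n (leq0n n); rewrite expr0 divr1 /=.
  by have := e0 n; lra.
have cvgu : u @ \oo --> limn (fun n => u n - 2 * K / 2 ^+ n).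
  have uE : u = fun n => (u n - 2 * K / 2 ^+ n) + 2 * K / 2 ^+ n.
    by apply/funext => n; rewrite subrK.
  rewrite [X in X @ _]uE -[X in _ --> X]addr0.
  by apply: cvgD; [exact: cvg_lo|exact: cvg_div_expn2].
have cvg_hi : (- u n - 2 * K / 2 ^+ n) @[n --> \oo] -->
    - limn (fun n => u n - 2 * K / 2 ^+ n).
  rewrite -[X in _ --> X]subr0; apply: cvgB; last exact: cvg_div_expn2.
  exact: cvgN.
move=> n; rewrite (cvg_lim _ cvgu) //.
have lo_le := nondecreasing_cvgn_le lo cvg_lo n.
have hi_le := nondecreasing_cvgn_le hi (cvgP _ cvg_hi) n.
rewrite (cvg_lim _ cvg_hi) // in hi_le.
by rewrite ler_norml; apply/andP; split; lra.
Qed.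

End GeometricConvergence.

Section ExponentialComparison.
Context (R : realType).
Implicit Types (f : R -> R) (L B T : R).

Lemma is_derive_exp_weight L B (t : R) :
  is_derive t 1 (fun s : R => B / 2 * expR (2 * L * s)) (L * B * expR (2 * L * t)).
Proof.
have dlin : is_derive t 1 (fun s : R => 2 * L * s) (2 * L).
  by apply: is_derive_eq; rewrite /GRing.scale /= mulr1.
have dexp : is_derive t 1 (fun s : R => expR (2 * L * s)) (expR (2 * L * t) * (2 * L)).
  exact: (is_derive1_comp (f := expR)).
have := is_deriveZ (B / 2) dexp; rewrite /GRing.scale /=.
by have -> : B / 2 * (expR (2 * L * t) * (2 * L)) = L * B * expR (2 * L * t) by field.
Qed.

Let upper_comparison L B T f (f' : R -> R) : 0 < L -> 0 <= B -> 0 <= T ->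
  {within `[0, T], continuous f} ->
  (forall t, 0 < t < T -> is_derive t 1 f (f' t)) -> f 0 = 0 ->
  (forall t, 0 < t < T -> f' t <= L * B * expR (2 * L * t)) ->
  f T <= B / 2 * expR (2 * L * T).
Proof.
move=> L0 B0 T0 cf df f0 leB.
pose g t := B / 2 * expR (2 * L * t) - f t.
have dg t : 0 < t < T -> is_derive t 1 g (L * B * expR (2 * L * t) - f' t).
  move=> tT; have := df t tT => dft.
  apply: is_deriveB => //; exact: is_derive_exp_weight.
have cexp : continuous (fun t => B / 2 * expR (2 * L * t)).
  move=> t; apply: cvgM; first exact: cvg_cst.
  apply: continuous_comp; last exact: continuous_expR.
  by apply: cvgM; [exact: cvg_cst|exact: cvg_id].
have cg : {within `[0, T], continuous g}.
  by move=> t; apply: cvgB; [exact: (continuous_subspaceT cexp)|exact: cf].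
have drg t : t \in `]0, T[%R -> derivable g t 1.
  by rewrite in_itv /= => /dg[].
have drg_ge0 t : t \in `]0, T[%R -> 0 <= derive1 g t.
  rewrite in_itv /= => tT; have dgt := dg t tT.
  by rewrite derive1E derive_val subr_ge0 leB.
have : g 0 <= g T.
  by apply: (ger0_derive1_le_cc drg drg_ge0 cg); rewrite ?in_itv /= ?lexx ?T0.
rewrite /g f0 subr0 mulr0 expR0 mulr1 => ?; lra.
Qed.

(** The weight exp (2 L t) is chosen so that its primitive gains a factor
    1 / (2 L): a derivative of size L B exp (2 L t) yields a function of size
    (B / 2) exp (2 L t).  This gives contraction on intervals of any length. *)
Lemma exponential_comparison L B T f (f' : R -> R) : 0 < L -> 0 <= B -> 0 <= T ->
  {within `[0, T], continuous f} ->
  (forall t, 0 < t < T -> is_derive t 1 f (f' t)) -> f 0 = 0 ->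
  (forall t, 0 < t < T -> `|f' t| <= L * B * expR (2 * L * t)) ->
  `|f T| <= B / 2 * expR (2 * L * T).
Proof.
move=> L0 B0 T0 cf df f0 leB; rewrite ler_norml lerNl; apply/andP; split.
  apply: (@upper_comparison L B T (fun t => - f t) (fun t => - f' t)) => //.
  - by move=> t; apply: cvgN; exact: cf.
  - by move=> t /df dft; exact: is_deriveN.
  - by rewrite f0 oppr0.
  - by move=> t /leB; rewrite ler_norml lerNl => /andP[].
apply: (@upper_comparison L B T f f') => // t /leB.
by apply: le_trans; exact: ler_norm.
Qed.

End ExponentialComparison.

Section Uniqueness.
Context (R : realType) (I : finType).

(** The Lipschitz condition is required only along the two solutions, so the
    right-hand side may be merely locally Lipschitz.  The difference is bounded
    by compactness, and each application of [exponential_comparison] halves the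
    bound. *)
Lemma ode_uniqueness (L T : R) (y z y' z' : R -> I -> R) : 0 < L -> 0 <= T ->
  (forall i, {within `[0, T], continuous y^~ i}) ->
  (forall i, {within `[0, T], continuous z^~ i}) ->
  (forall i t, 0 < t < T -> is_derive t 1 (y^~ i) (y' t i)) ->
  (forall i t, 0 < t < T -> is_derive t 1 (z^~ i) (z' t i)) ->
  (forall i, y 0 i = z 0 i) ->
  (forall (t B : R), 0 < t < T -> (forall i, `|y t i - z t i| <= B) ->
    forall i, `|y' t i - z' t i| <= L * B) ->
  forall i, y T i = z T i.
Proof.
move=> L0 T0 cy cz dy dz yz0 lip.
have cyz i : {within `[0, T], continuous (fun t => y t i - z t i)}.
  by move=> t; apply: cvgB; [exact: cy|exact: cz].
have [B B0 yzB] : exists2 B, 0 <= B &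
    forall t i, 0 <= t <= T -> `|y t i - z t i| <= B.
  have ex_bound i : exists B, forall t, 0 <= t <= T -> `|y t i - z t i| <= B.
    have cn : {within `[0, T], continuous (fun t => `|y t i - z t i|)}.
      by move=> t; apply: cvg_norm; exact: cyz.
    have [c _ cmax] := EVT_max T0 cn.
    by exists `|y c i - z c i| => t tT; apply: cmax; rewrite in_itv.
  have [B BP] := choice ex_bound.
  have B0 i : 0 <= B i by apply: le_trans (BP i 0 _); rewrite ?lexx.
  exists (\sum_i B i); first exact: sumr_ge0.
  move=> t i tT; apply: le_trans (BP i t tT) _.
  by rewrite (bigD1 i) //= lerDl sumr_ge0.
have decay n : forall t i, 0 <= t <= T ->
    `|y t i - z t i| <= B / 2 ^+ n * expR (2 * L * t).
  elim: n => [|n IHn] t i tT.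
    rewrite expr0 divr1; apply: le_trans (yzB t i tT) _.
    rewrite ler_peMr // -expR0 ler_expR.
    by case/andP: tT => t0 _; rewrite !mulr_ge0 // ltW.
  case/andP: tT => t0 tT.
  have in_T s : 0 < s < t -> 0 < s < T.
    by case/andP=> -> st; exact: lt_le_trans st tT.
  rewrite exprSr invfM mulrA.
  apply: (@exponential_comparison _ L (B / 2 ^+ n) t
    (fun s => y s i - z s i) (fun s => y' s i - z' s i)) => //.
  - by rewrite divr_ge0 // exprn_ge0.
  - apply: continuous_subspaceW (cyz i).
    by apply: subset_itvl; rewrite bnd_simp.
  - move=> s /in_T sT; have := dy i s sT; have := dz i s sT => ? ?.
    exact: is_deriveB.
  - by rewrite yz0 subrr.
  - move=> s st; rewrite -mulrA; apply: lip => [|j]; first exact: in_T.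
    by apply: IHn; case/andP: (in_T _ st) => /ltW -> /ltW.
move=> i; apply/eqP; rewrite -subr_eq0 -normr_le0.
apply: (@le0_div_expn2 _ _ (B * expR (2 * L * T))) => n.
by rewrite mulrAC decay // T0 lexx.
Qed.

End Uniqueness.

(** * Picard iteration *)

Section Primitive.
Context (R : realType).

(** Integration starts at -1 rather than 0 so that the derivative at 0 is
    two-sided. *)
Definition primitive (f : R -> R) (t : R) : R :=
  (\int[lebesgue_measure]_(s in `[-1, t]) f s
    - \int[lebesgue_measure]_(s in `[-1, 0%R]) f s)%R.

Lemma primitive0 f : primitive f 0 = 0.
Proof. exact: subrr. Qed.

Lemma is_derive_primitive f (t : R) : continuous f -> -1 < t ->
  is_derive t 1 (primitive f) (f t).
Proof.
move=> cf t1; rewrite -[f t]subr0; apply: is_deriveB.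
have int_f : lebesgue_measure.-integrable `[-1, t + 1] (EFin \o f).
  apply: continuous_compact_integrable; first exact: segment_compact.
  exact: continuous_subspaceT.
have lt_t : t < t + 1 by rewrite ltrDl.
have [dF FE] := continuous_FTC1_closed lt_t int_f t1 (cf t).
by split; [exact: dF|rewrite -derive1E; exact: FE].
Qed.

End Primitive.

Section Existence.
Context (R : realType) (I : finType) (F : (I -> R) -> I -> R) (L : R).
Hypothesis L_gt0 : 0 < L.
Hypothesis F_lipschitz : forall (p q : I -> R) (B : R),
  (forall i, `|p i - q i| <= B) -> forall i, `|F p i - F q i| <= L * B.
Variable y0 : I -> R.
Implicit Types (y z : R -> I -> R) (i j : I) (t : R).

(** Iterates are controlled for t >= 0 only, so they are evaluated at
    max t 0 inside the integral; integrands are then continuous everywhere. *)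
Let pos (t : R) : R := Num.max t 0.

Let pos_id t : 0 <= t -> pos t = t.
Proof. by move=> t0; rewrite /pos max_l. Qed.

Let pos_ge0 t : 0 <= pos t.
Proof. by rewrite /pos le_max lexx orbT. Qed.

Let pos_continuous : continuous pos.
Proof.
move=> t; apply: (@continuous_max _ _ id (cst 0)); first exact: cvg_id.
exact: cvg_cst.
Qed.

Lemma lipschitz_comp_continuous (g : R -> I -> R) i :
  (forall j, continuous (g^~ j)) -> continuous (fun t => F (g t) i).
Proof.
move=> cg t; apply/cvgrPdist_le => e e0; near=> s.
rewrite -(divfK (lt0r_neq0 L_gt0) e) mulrC; apply: F_lipschitz.
near: s; apply: filter_forall => j.
by move/cvgrPdist_le: (cg j t); apply; rewrite divr_gt0.
Unshelve. all: by end_near. Qed.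

Let step (y : R -> I -> R) (t : R) (i : I) : R :=
  y0 i + primitive (fun s => F (y (pos s)) i) t.

Let step0 y i : step y 0 i = y0 i.
Proof. by rewrite /step primitive0 addr0. Qed.

Let is_derive_step y i t : (forall j, continuous (fun s => y (pos s) j)) ->
  -1 < t -> is_derive t 1 ((step y)^~ i) (F (y (pos t)) i).
Proof.
move=> cy t1; rewrite -[F _ i]add0r; apply: is_deriveD.
by apply: is_derive_primitive => //; exact: lipschitz_comp_continuous.
Qed.

Let gtN1 (t : R) : 0 <= t -> -1 < t.
Proof. by apply: lt_le_trans; rewrite ltrN10. Qed.

Let step_continuous y i t : (forall j, continuous (fun s => y (pos s) j)) ->
  -1 < t -> {for t, continuous ((step y)^~ i)}.
Proof.
move=> cy t1; apply: differentiable_continuous; apply/derivable1_diffP.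
by case: (is_derive_step i cy t1).
Qed.

Let step_pos_continuous y : (forall j, continuous (fun s => y (pos s) j)) ->
  forall j, continuous (fun s => step y (pos s) j).
Proof.
move=> cy j t; apply: (@continuous_comp _ _ _ pos ((step y)^~ j)).
  exact: pos_continuous.
by apply: step_continuous => //; exact: gtN1.
Qed.

Let iterate n : R -> I -> R := iter n step (fun=> y0).

Let iterate_continuous n j : continuous (fun s => iterate n (pos s) j).
Proof.
elim: n j => [|n IHn] j; first exact: cst_continuous.
exact: step_pos_continuous.
Qed.

(** The weight exp (2 L t) makes the Picard operator a contraction with factor
    1/2 on the whole half-line at once, so no short intervals are glued. *)
Let step_close y z (B : R) : 0 <= B ->
  (forall j, continuous (fun s => y (pos s) j)) ->
  (forall j, continuous (fun s => z (pos s) j)) ->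
  (forall t i, 0 <= t -> `|y t i - z t i| <= B * expR (2 * L * t)) ->
  forall t i, 0 <= t -> `|step y t i - step z t i| <= B / 2 * expR (2 * L * t).
Proof.
move=> B0 cy cz yzB t i t0.
have dyz (s : R) : -1 < s ->
    is_derive s 1 (fun s : R => step y s i - step z s i) (F (y (pos s)) i - F (z (pos s)) i).
  by move=> s1; apply: is_deriveB; exact: is_derive_step.
apply: (@exponential_comparison _ L B t (fun s => step y s i - step z s i)
   (fun s => F (y (pos s)) i - F (z (pos s)) i)) => //.
- apply: derivable_within_continuous => s; rewrite in_itv /= => /andP[s0 _].
  by case: (dyz s (gtN1 s0)).
- by move=> s /andP[s0 _]; apply: dyz; exact: gtN1 (ltW s0).
- by rewrite !step0 subrr.
- move=> s /andP[s0 _]; rewrite -mulrA; apply: F_lipschitz => j.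
  by rewrite pos_id ?yzB ?ltW.
Qed.

(** The iterates converge geometrically, locally uniformly in time.  The limit
    is a fixed point of the Picard operator for t >= 0, hence a solution. *)
Lemma ode_existence : exists y : R -> I -> R, (forall i, y 0 i = y0 i) /\
  forall t i, 0 <= t -> is_derive t 1 (y^~ i) (F (y t) i).
Proof.
pose M := \sum_i `|F y0 i|.
have M0 : 0 <= M by exact: sumr_ge0.
have exp_ge1 t : 0 <= t -> 1 <= expR (2 * L * t).
  by move=> t0; rewrite -expR0 ler_expR !mulr_ge0 // ltW.
pose C := M / L / 2.
have C0 : 0 <= C by rewrite !divr_ge0 // ltW.
have base t i : 0 <= t ->
    `|iterate 1 t i - iterate 0 t i| <= C * expR (2 * L * t).
  move=> t0; have d1 (s : R) : -1 < s ->
      is_derive s 1 (fun s : R => iterate 1 s i - y0 i) (F y0 i).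
    move=> s1; rewrite -[F y0 i]subr0; apply: is_deriveB.
    by apply: (@is_derive_step (fun=> y0)) => // j; exact: cst_continuous.
  apply: (@exponential_comparison _ L (M / L) t (fun s => iterate 1 s i - y0 i)
     (fun=> F y0 i)) => //.
  - by rewrite divr_ge0 // ltW.
  - apply: derivable_within_continuous => s; rewrite in_itv /= => /andP[s0 _].
    by case: (d1 s (gtN1 s0)).
  - by move=> s /andP[s0 _]; apply: d1; exact: gtN1 (ltW s0).
  - by rewrite /iterate /= step0 subrr.
  - move=> s /andP[s0 _]; rewrite mulrCA divff ?gt_eqF // mulr1.
    apply: (@le_trans _ _ M); first by rewrite /M (bigD1 i) //= lerDl sumr_ge0.
    by rewrite ler_peMr // exp_ge1 // ltW.
have contract n t i : 0 <= t ->
    `|iterate n.+1 t i - iterate n t i| <= C / 2 ^+ n * expR (2 * L * t).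
  elim: n t i => [|n IHn] t i t0; first by rewrite expr0 divr1 base.
  rewrite exprSr invfM mulrA.
  apply: (step_close _ (@iterate_continuous n.+1) (@iterate_continuous n)) => //.
  by rewrite divr_ge0 // exprn_ge0.
pose y t i := limn (fun n => iterate n t i).
have y_close : forall m t i, 0 <= t ->
    `|y t i - iterate m t i| <= 2 * C / 2 ^+ m * expR (2 * L * t).
  move=> m t i t0; rewrite [leRHS]mulrAC -[2 * C * _]mulrA.
  apply: (@geometric_cvg _ (fun n => iterate n t i) (C * expR (2 * L * t))) => n.
  by rewrite mulrAC contract.
have cy j : continuous (fun s => y (pos s) j).
  move=> t; apply/cvgrPdist_le => e e0.
  pose E := 2 * C * expR (2 * L * (pos t + 1)).
  have [n En] : exists n, E / 2 ^+ n <= e / 3.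
    have e3 : 0 < e / 3 by rewrite divr_gt0.
    have /cvgrPdist_le/(_ _ e3) := @cvg_div_expn2 R E.
    case=> n _ /(_ n (leqnn n)) /=; rewrite sub0r normrN => En.
    by exists n; apply: le_trans (ler_norm _) En.
  near=> s.
  have close r : 0 <= r -> r <= pos t + 1 -> `|y r j - iterate n r j| <= e / 3.
    move=> r0 rt; apply: le_trans (y_close n r j r0) _; apply: le_trans En.
    rewrite mulrAC ler_pM2r ?invr_gt0 ?exprn_gt0 // ler_wpM2l //.
      by rewrite mulr_ge0.
    by rewrite ler_expR ler_wpM2l // mulr_ge0 // ltW.
  have close_t : `|y (pos t) j - iterate n (pos t) j| <= e / 3.
    by apply: close => //; rewrite lerDl.
  have close_s : `|y (pos s) j - iterate n (pos s) j| <= e / 3.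
    apply: close => //; near: s.
    have /cvgrPdist_le/(_ _ ltr01) := @pos_continuous t.
    by apply: filterS => s; rewrite ler_norml => /andP[+ _]; lra.
  have close_ts : `|iterate n (pos t) j - iterate n (pos s) j| <= e / 3.
    near: s; have /cvgrPdist_le := @iterate_continuous n j t.
    by apply; rewrite divr_gt0.
  move: close_t close_s close_ts; rewrite !ler_norml => /andP[? ?] /andP[? ?] /andP[? ?].
  by apply/andP; split; lra.
have y_fix t i : 0 <= t -> step y t i = y t i.
  move=> t0; apply/eqP; rewrite -subr_eq0 -normr_le0.
  apply: (@le0_div_expn2 _ _ (2 * C * expR (2 * L * t))) => n.
  have B0 : 0 <= 2 * C / 2 ^+ n by rewrite divr_ge0 ?exprn_ge0 // mulr_ge0.
  have := step_close B0 cy (@iterate_continuous n) (y_close n) i t0.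
  have := y_close n.+1 t i t0.
  have -> : 2 * C / 2 ^+ n.+1 = 2 * C / 2 ^+ n / 2 by rewrite exprSr invfM mulrA.
  rewrite [_ / 2 ^+ n]mulrAC -[iterate n.+1]/(step (iterate n)).
  move: (2 * C / 2 ^+ n) => K.
  rewrite !ler_norml => /andP[? ?] /andP[? ?].
  by apply/andP; split; lra.
exists (step y); split=> [i|t i t0]; first exact: step0.
have := is_derive_step i cy (gtN1 t0); rewrite pos_id //.
by have -> : step y t = y t by apply/funext => j; exact: y_fix.
Unshelve. all: by end_near. Qed.

End Existence.

(** * The Ricci flow *)

Section RicciFlow.
Context (R : realType) (V : finType) (G : rel V).
Hypotheses (G_loopless : irreflexive G) (G_sc : strongly_connected G).
Context (len : V -> V -> R).
Hypothesis len_gt0 : forall u v : V, G u v -> 0 < len u v.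
Context (beta : V -> R).
Hypothesis beta01 : forall x : V, 0 <= beta x <= 1.
Local Notation edge_kappa := (edge_kappa len beta).
Local Notation ricci_rhs := (ricci_rhs len beta).

(** Summing the bounds of the single edges gives one constant for all. *)
Lemma edge_kappa_bounded_lipschitz : exists2 M : R, 0 <= M &
  (forall (w : edge G -> R) e, (forall h, 0 < w h) -> `|edge_kappa w e| <= M) /\
  (forall (p q : edge G -> R) B, (forall e, `|p e - q e| <= B) ->
    forall e, `|edge_kappa (expR \o p) e - edge_kappa (expR \o q) e| <= 2 * M * B).
Proof.
pose c (e : edge G) := curvature_bound G len (val e).1 (val e).2.
have one_gt0 (e : edge G) : 0 < (fun=> 1 : R) e by exact: ltr01.
have kb (e : edge G) w := kappa_bound G_loopless G_sc len_gt0 beta01 (valP e) (w := w).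
have c0 e : 0 <= c e by exact: le_trans (normr_ge0 _) (kb e _ one_gt0).
have c_le e : c e <= \sum_h c h by rewrite (bigD1 e) //= lerDl sumr_ge0.
exists (\sum_h c h); first exact: sumr_ge0.
split=> [w e w0|p q B pqB e]; first exact: le_trans (kb e w w0) (c_le e).
have B0 : 0 <= B by exact: le_trans (normr_ge0 _) (pqB e).
have := kappa_lipschitz G_loopless G_sc len_gt0 beta01 (valP e) pqB.
move=> /le_trans; apply; rewrite ler_wpM2r // ler_wpM2l //; exact: c_le.
Qed.

Lemma is_derive_sum_fin (I : finType) (f : I -> R -> R) (df : I -> R) (t : R) :
  (forall i, is_derive t 1 (f i) (df i)) ->
  is_derive t 1 (fun s => \sum_i f i s) (\sum_i df i).
Proof.
move=> dfi; elim: (index_enum I) => [|i r IHr].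
  rewrite big_nil; under eq_fun do rewrite big_nil; exact: is_derive_cst.
rewrite big_cons; under eq_fun do rewrite big_cons; exact: is_deriveD.
Qed.

Lemma is_derive_right (f : R -> R) (df : R) : is_derive (0 : R) 1 f df ->
  (f s - f 0) / s @[s --> 0^'+] --> df.
Proof.
case=> f_der <-.
have quot : s^-1 *: (f (s *: 1 + 0) - f 0) @[s --> 0^'+] --> 'D_1 f 0.
  apply: cvg_trans f_der; apply: cvg_app; apply: within_subset.
  by move=> s /=; rewrite lt_def => /andP[].
apply: cvg_trans quot; apply: near_eq_cvg; apply: nearW => s.
by rewrite /GRing.scale /= mulr1 addr0 mulrC.
Qed.

Lemma ricci_rhs_scale (w : edge G -> R) (k : R) e : 0 < k ->
  ricci_rhs (fun h => k * w h) e =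
    - edge_kappa w e * (k * w e) + k * w e * (k * \sum_h edge_kappa w h * w h).
Proof.
move=> k0; have kE h : edge_kappa (fun h => k * w h) h = edge_kappa w h.
  exact: kappa_scale.
rewrite /Defs.ricci_rhs kE; congr (_ + _ * _).
by rewrite mulr_sumr; apply: eq_bigr => h _; rewrite kE mulrCA.
Qed.

Definition normalized_exp (y : R -> edge G -> R) (t : R) (e : edge G) : R :=
  expR (y t e) / \sum_h expR (y t h).

(** By scale invariance the curvature of the normalised weights is that of
    exp y; the derivative of the normalising factor produces exactly the
    quadratic term of the flow. *)
Lemma ricci_rhs_normalized_exp (y : R -> edge G -> R) (t : R) (e : edge G)
   (dy : forall h, is_derive t 1 (y^~ h) (- edge_kappa (expR \o y t) h)) :
  is_derive t 1 ((normalized_exp y)^~ e) (ricci_rhs (normalized_exp y t) e).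
Proof.
pose u h := expR (y t h); pose S := \sum_h u h.
have S0 : 0 < S.
  by rewrite /S (bigD1 e) //= ltr_pwDl ?expR_gt0 // sumr_ge0 // => h _; exact: expR_ge0.
have du h : is_derive t 1 (fun s => expR (y s h)) (u h * - edge_kappa u h).
  by have dyh := dy h; exact: (is_derive1_comp (f := expR)).
have dS := is_derive_sum_fin du.
have dV := is_deriveV (f := fun s => \sum_h expR (y s h)) (lt0r_neq0 S0) dS.
have wE : normalized_exp y t = fun h => S^-1 * u h.
  by apply/funext => h; rewrite mulrC.
have -> : ricci_rhs (normalized_exp y t) e =
    u e *: (- S ^- 2 *: \sum_h u h * - edge_kappa u h) + S^-1 *: (u e * - edge_kappa u e).
  rewrite wE ricci_rhs_scale ?invr_gt0 // /GRing.scale /=.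
  have -> : \sum_h u h * - edge_kappa u h = - \sum_h edge_kappa u h * u h.
    by rewrite -sumrN; apply: eq_bigr => h _; rewrite mulrN mulrC.
  by field; rewrite gt_eqF.
exact: is_deriveM (du e) dV.
Qed.

(** The solution of the equation without normalisation term is defined on both
    sides of 0, which gives the right derivative at 0. *)
Lemma ricci_flow_exists (w0 : edge G -> R) : (forall e, 0 < w0 e) ->
  \sum_e w0 e = 1 -> exists w, ricci_flow_solution len beta w0 w.
Proof.
move=> w0_gt0 w0_sum1; have [M M0 [_ lip]] := edge_kappa_bounded_lipschitz.
have L0 : 0 < 2 * M + 1 by rewrite ltr_wpDl // mulr_ge0.
have [p q B pqB e|y [y_init dy]] := @ode_existence R (edge G)
    (fun p e => - edge_kappa (expR \o p) e) _ L0 _ (fun e => ln (w0 e)).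
  have B0 : 0 <= B by exact: le_trans (normr_ge0 _) (pqB e).
  rewrite -opprD normrN; apply: le_trans (lip p q B pqB e) _.
  by rewrite ler_wpM2r // lerDl.
have w_init e : normalized_exp y 0 e = w0 e.
  have yE h : expR (y 0 h) = w0 h by rewrite y_init lnK ?posrE.
  by rewrite /normalized_exp (eq_bigr _ (fun h _ => yE h)) w0_sum1 divr1 yE.
have dw (t : R) e : 0 <= t ->
    is_derive t 1 ((normalized_exp y)^~ e) (ricci_rhs (normalized_exp y t) e).
  by move=> t0; apply: ricci_rhs_normalized_exp => h; exact: dy.
exists (normalized_exp y); split=> // [t e _|t e t0|e]; last 2 first.
- exact: dw (ltW t0).
- exact: is_derive_right (dw 0 e (lexx 0)).
apply: divr_gt0; first exact: expR_gt0.
rewrite (bigD1 e) //= ltr_pwDl ?expR_gt0 // sumr_ge0 // => h _; exact: expR_ge0.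
Qed.

Section Solution.
Variables (w0 : edge G -> R) (v : R -> edge G -> R).
Hypothesis v_sol : ricci_flow_solution len beta w0 v.

Let v_gt0 (t : R) e : 0 <= t -> 0 < v t e.
Proof. by case: v_sol => + _ _ _; apply. Qed.

Let dv (t : R) e : 0 < t -> is_derive t 1 (v^~ e) (ricci_rhs (v t) e).
Proof. by case: v_sol => _ _ + _; apply. Qed.

Let v_continuous (t : R) e : 0 < t -> {for t, continuous (v^~ e)}.
Proof.
move=> t0; apply: differentiable_continuous; apply/derivable1_diffP.
by case: (dv e t0).
Qed.

Let v_right e : v s e @[s --> 0^'+] --> v 0 e.
Proof.
have [_ _ _ /(_ e) dv0] := v_sol.
have s_cvg : s @[s --> (0 : R)^'+] --> (0 : R).
  by apply: cvg_at_right_filter; exact: cvg_id.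
have prod_cvg : (v s e - v 0 e) / s * s + v 0 e @[s --> 0^'+] -->
    ricci_rhs (v 0) e * 0 + v 0 e.
  by apply: cvgD; [exact: cvgM dv0 s_cvg|exact: cvg_cst].
rewrite mulr0 add0r in prod_cvg.
apply: cvg_trans prod_cvg; apply: near_eq_cvg; near=> s.
have s0 : 0 < s by near: s; exact: nbhs_right_gt.
by rewrite /= divfK ?gt_eqF // subrK.
Unshelve. all: by end_near. Qed.

Lemma solution_continuous (T : R) e : 0 < T -> {within `[0, T], continuous (v^~ e)}.
Proof.
move=> T0; apply/continuous_within_itvP => //; split.
- by move=> t; rewrite in_itv /= => /andP[t0 _]; exact: v_continuous.
- exact: v_right.
- by apply: cvg_at_left_filter; exact: v_continuous.
Qed.

Lemma solution_ln_continuous (T : R) e : 0 < T ->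
  {within `[0, T], continuous (fun t => ln (v t e))}.
Proof.
move=> T0; apply/continuous_within_itvP => //; split.
- move=> t; rewrite in_itv /= => /andP[t0 _].
  apply: (@continuous_comp _ _ _ (v^~ e)); first exact: v_continuous.
  exact/continuous_ln/v_gt0/ltW.
- apply: (continuous_cvg _ (f := v^~ e) (h := @ln R)); last exact: v_right.
  exact/continuous_ln/v_gt0.
- apply: (continuous_cvg _ (f := v^~ e) (h := @ln R)); first exact/continuous_ln/v_gt0/ltW.
  by apply: cvg_at_left_filter; exact: v_continuous.
Qed.

(** In logarithmic coordinates, an upper bound on the weights makes the
    exponentials exp p_h of the flow equation Lipschitz. *)
Lemma solution_bounded (T : R) : 0 < T ->
  exists M : R, forall t e, 0 <= t <= T -> v t e <= M.
Proof.
move=> T0.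
have ex_bound e : exists M, 0 <= M /\ forall t, 0 <= t <= T -> v t e <= M.
  have [c c_itv cmax] := EVT_max (ltW T0) (solution_continuous (e := e) T0).
  exists (v c e); split; last by move=> t tT; apply: cmax; rewrite in_itv.
  by move: c_itv; rewrite in_itv /= => /andP[c0 _]; exact/ltW/v_gt0.
have [M MP] := choice ex_bound; exists (\sum_e M e) => t e tT.
have [_ /(_ t tT) vM] := MP e; apply: (le_trans vM).
rewrite (bigD1 e) //= lerDl sumr_ge0 // => h _; by case: (MP h).
Qed.

Lemma solution_ln_derive (t : R) e : 0 < t ->
  is_derive t 1 (fun s => ln (v s e))
    (- edge_kappa (expR \o (fun h => ln (v t h))) e +
     \sum_h edge_kappa (expR \o (fun h => ln (v t h))) h * v t h).
Proof.
move=> t0; have vt0 h : 0 < v t h by exact/v_gt0/ltW.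
have vE : expR \o (fun h => ln (v t h)) = v t.
  by apply/funext => h /=; rewrite lnK ?posrE.
have dve := dv e t0; have dln := is_derive1_ln (vt0 e).
have := is_derive1_comp (f := @ln R) (g := v^~ e); rewrite vE.
move=> /(_ t _ _ dln dve); congr (is_derive _ _ _ _).
by rewrite /Defs.ricci_rhs; field; rewrite gt_eqF.
Qed.

End Solution.

Lemma expR_lipschitz (a b M : R) : expR a <= M -> expR b <= M ->
  `|expR a - expR b| <= M * `|a - b|.
Proof.
have one_side (c d : R) : expR c <= M -> expR c - expR d <= M * `|c - d|.
  move=> cM; apply: (@le_trans _ _ (expR c * (c - d))).
    have -> : expR d = expR c * expR (d - c) by rewrite -expRD addrCA subrr addr0.
    rewrite -[X in X - _]mulr1 -mulrBr ler_wpM2l ?expR_ge0 //.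
    by have := expR_ge1Dx (d - c); lra.
  apply: le_trans (ler_wpM2r (normr_ge0 _) cM).
  by rewrite ler_wpM2l ?expR_ge0 // ler_norm.
move=> aM bM; rewrite ler_norml lerNl opprB one_side // andbT.
by rewrite distrC one_side.
Qed.

(** Along two solutions bounded by M on [0, T], the linear term has Lipschitz
    constant 2K, and each product kappa_h exp p_h has 2K M + K M. *)
Lemma ricci_flow_unique (w0 : edge G -> R) (v w : R -> edge G -> R) :
  ricci_flow_solution len beta w0 v -> ricci_flow_solution len beta w0 w ->
  forall t e, 0 <= t -> v t e = w t e.
Proof.
move=> v_sol w_sol T e; rewrite le_eqVlt => /predU1P[<-|T0].
  by case: v_sol => _ -> _ _; case: w_sol => _ -> _ _.
have [v_gt0 v_init _ _] := v_sol; have [w_gt0 w_init _ _] := w_sol.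
have [K K0 [bound lip]] := edge_kappa_bounded_lipschitz.
have [Mv vM] := solution_bounded v_sol T0.
have [Mw wM] := solution_bounded w_sol T0.
pose M := Num.max Mv Mw.
have M0 : 0 <= M.
  have Mv0 : 0 <= Mv.
    by apply: le_trans (ltW (v_gt0 0 e (lexx 0))) (vM 0 e _); rewrite lexx ltW.
  by rewrite /M le_max Mv0.
pose L := 2 * K + \sum_(h : edge G) (2 * K * M + K * M) + 1.
have sum0 : 0 <= \sum_(h : edge G) (2 * K * M + K * M).
  by apply: sumr_ge0 => h _; rewrite addr_ge0 ?mulr_ge0.
have L0 : 0 < L by rewrite ltr_wpDl // addr_ge0 // mulr_ge0.
suff ln_eq : ln (v T e) = ln (w T e).
  by apply: ln_inj => //; rewrite posrE ?v_gt0 ?w_gt0 ?ltW.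
apply: (ode_uniqueness (y := fun t h => ln (v t h)) (z := fun t h => ln (w t h))
  L0 (ltW T0)).
- by move=> h; exact: (solution_ln_continuous v_sol T0).
- by move=> h; exact: (solution_ln_continuous w_sol T0).
- by move=> h t /andP[t0 _]; exact: (solution_ln_derive v_sol).
- by move=> h t /andP[t0 _]; exact: (solution_ln_derive w_sol).
- by move=> h; rewrite v_init w_init.
move=> t B /andP[t0 tT] close h.
have tT' : 0 <= t <= T by rewrite !ltW.
have B0 : 0 <= B by exact: le_trans (normr_ge0 _) (close h).
set p := fun h => ln (v t h); set q := fun h => ln (w t h).
have vE g : v t g = expR (p g) by rewrite lnK ?posrE // v_gt0 // ltW.
have wE g : w t g = expR (q g) by rewrite lnK ?posrE // w_gt0 // ltW.
have vMt g : expR (p g) <= M by rewrite -vE /M le_max vM.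
have wMt g : expR (q g) <= M by rewrite -wE /M le_max wM ?orbT.
have kq g : `|edge_kappa (expR \o q) g| <= K by apply: bound => f; exact: expR_gt0.
have -> : forall a b c d : R, - a + b - (- c + d) = (b - d) - (a - c).
  by move=> a b c d; ring.
rewrite -sumrB; apply: le_trans (ler_normB _ _) _.
rewrite addrC; apply: (@le_trans _ _ (2 * K * B + \sum_(g : edge G) (2 * K * M + K * M) * B)).
  apply: lerD; first exact: lip.
  apply: le_trans (ler_norm_sum _ _ _) _; apply: ler_sum => g _.
  rewrite vE wE.
  have -> : forall a b c d : R, a * b - c * d = (a - c) * b + c * (b - d).
    by move=> a b c d; ring.
  apply: le_trans (ler_normD _ _) _; rewrite !normrM mulrDl.
  apply: lerD.
    rewrite [2 * K * M * B]mulrAC; apply: ler_pM => //; first exact: lip.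
    by rewrite ger0_norm ?expR_ge0.
  rewrite -mulrA; apply: ler_pM => //.
  by apply: le_trans (expR_lipschitz (vMt g) (wMt g)) _; rewrite ler_wpM2l ?close.
by rewrite -mulr_suml -mulrDl ler_wpM2r // lerDl.
Qed.

End RicciFlow.

Theorem theorem4p2 (R : realType) (V : finType) (G : rel V)
    (G_loopless : irreflexive G) (G_sc : strongly_connected G)
    (len : V -> V -> R) (len_gt0 : forall u v : V, G u v -> 0 < len u v)
    (beta : V -> R) (beta01 : forall x : V, 0 <= beta x <= 1)
    (w0 : edge G -> R) (w0_gt0 : forall e : edge G, 0 < w0 e)
    (w0_sum1 : \sum_(e : edge G) w0 e = 1) :
  exists w : R -> edge G -> R,
    ricci_flow_solution len beta w0 w /\
    forall v : R -> edge G -> R, ricci_flow_solution len beta w0 v ->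
      forall (t : R) (e : edge G), 0 <= t -> v t e = w t e.
Proof.
have [w w_sol] := ricci_flow_exists G_loopless G_sc len_gt0 beta01 w0_gt0 w0_sum1.
exists w; split=> // v v_sol t e t0.
exact: (ricci_flow_unique G_loopless G_sc len_gt0 beta01 v_sol w_sol).
Qed.
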